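(* Let $N \ge 3$ and let $\mathbf{A} \in \mathbb{R}^{N\times N}$ be the circulant matrix with $-2$ on the diagonal, with entry $1$ at every position $(j,k)$ with $j-k \equiv \pm 1 \pmod N$, and with all other entries $0$. Then the Moore-Penrose inverse of $\mathbf{L} = -\mathbf{A}^2$ is a symmetric matrix of the form $\mathbf{L}^+ = -(\mathbf{A}^2)^+ = \mathrm{circ}(c_0^+, c_1^+, \ldots, c_{N-1}^+)$ with $$c_k^+ = \frac{(1-N^2)(N^2+11)}{720N} + \frac{k(N-k)(Nk-k^2+2)}{24N}, \qquad k=0,\ldots,N-1.$$
   Context: Rows and columns are indexed by $0,\ldots,N-1$. The notation $\mathrm{circ}(a_0,\ldots,a_{N-1})$ denotes the circulant $N\times N$ matrix with first column $(a_0,\ldots,a_{N-1})^T$, i.e. whose $(j,k)$ entry is $a_{(j-k) \bmod N}$. The Moore-Penrose inverse of a real square matrix $\mathbf{L}$ is the unique matrix $\mathbf{L}^+$ such that $\mathbf{L}\mathbf{L}^+\mathbf{L} = \mathbf{L}$, $\mathbf{L}^+\mathbf{L}\mathbf{L}^+ = \mathbf{L}^+$, and both $\mathbf{L}\mathbf{L}^+$ and $\mathbf{L}^+\mathbf{L}$ are symmetric. *)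

(* Defs.v *)
From mathcomp Require Import all_boot all_order all_algebra.
From mathcomp Require Import boolp classical_sets reals.

Set Implicit Arguments.
Unset Strict Implicit.
Unset Printing Implicit Defensive.

Import GRing.Theory Num.Theory.

Local Open Scope ring_scope.

Section MoorePenrose.
Variables (R : realType) (n : nat).
Implicit Types A X Y : 'M[R]_n.

Definition is_mpinv A X : Prop :=
  [/\ A *m X *m A = A, X *m A *m X = X,
      (A *m X)^T = A *m X & (X *m A)^T = X *m A].

Lemma is_mpinv_unique A X Y : is_mpinv A X -> is_mpinv A Y -> X = Y.
Proof.
move=> [AXA XAX AXt XAt] [AYA YAY AYt YAt].
have AXY : A *m X = A *m Y.
  by rewrite -AXt -{1}AYA -mulmxA trmx_mul AXt AYt mulmxA AXA.
have XYA : X *m A = Y *m A.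
  by rewrite -XAt -{1}AYA -mulmxA mulmxA trmx_mul XAt YAt -mulmxA (mulmxA A) AXA.
by rewrite -XAX -mulmxA AXY mulmxA XYA YAY.
Qed.

Lemma gram_unitmx m p (B : 'M[R]_(m, p)) : row_free B -> B *m B^T \in unitmx.
Proof.
move=> freeB; rewrite -row_free_unit; apply: inj_row_free => v vBB0.
apply: (row_free_inj freeB); rewrite mul0mx.
have : ((v *m B) *m (v *m B)^T) 0 0 = 0.
  by rewrite trmx_mul mulmxA -(mulmxA v) vBB0 mul0mx mxE.
rewrite mxE => /eqP; rewrite psumr_eq0 => [/allP sq0|j _]; last first.
  by rewrite [_^T _ _]mxE -expr2 sqr_ge0.
apply/matrixP => i j; rewrite (ord1 i) [RHS]mxE.
have /= := sq0 j (mem_index_enum j).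
by rewrite [_^T _ _]mxE -expr2 sqrf_eq0 => /eqP.
Qed.

Lemma is_mpinv_full_rank r (C : 'M[R]_(n, r)) (B : 'M[R]_(r, n)) :
  row_free C^T -> row_free B -> exists X, is_mpinv (C *m B) X.
Proof.
move=> /gram_unitmx; rewrite trmxK => uQ /gram_unitmx uP.
set P := B *m B^T in uP; set Q := C^T *m C in uQ.
have Pt : P^T = P by rewrite trmx_mul trmxK.
have Qt : Q^T = Q by rewrite trmx_mul trmxK.
pose X := B^T *m invmx P *m invmx Q *m C^T.
have AX : C *m B *m X = C *m invmx Q *m C^T.
  by rewrite /X !mulmxA -(mulmxA C B) -/P mulmxK.
have XA : X *m (C *m B) = B^T *m invmx P *m B.
  by rewrite /X !mulmxA -(mulmxA _ C^T C) -/Q mulmxKV.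
exists X; split.
- by rewrite AX !mulmxA -(mulmxA _ C^T C) -/Q mulmxKV.
- by rewrite XA /X !mulmxA -(mulmxA _ B) -/P mulmxKV.
- by rewrite AX !trmx_mul trmxK trmx_inv Qt mulmxA.
- by rewrite XA !trmx_mul trmxK trmx_inv Pt mulmxA.
Qed.

Lemma is_mpinv_exists A : exists X, is_mpinv A X.
Proof.
rewrite -(mulmx_base A); apply: is_mpinv_full_rank (row_base_free A).
by rewrite /row_free mxrank_tr; exact: col_base_full.
Qed.

(* The default value 0 is never used, by is_mpinv_exists. *)
Definition mpinv A : 'M[R]_n := xget 0 [set X | is_mpinv A X]%classic.

Lemma mpinvP A : is_mpinv A (mpinv A).
Proof. exact: xgetPex (is_mpinv_exists A). Qed.

End MoorePenrose.

(* Only the values a 0, ..., a N.-1 are used. As k < N, the natural number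
   j + (N - k) is congruent to j - k modulo N. *)
Definition circ (R : realType) (N : nat) (a : nat -> R) : 'M[R]_N :=
  \matrix_(j, k) a ((j + (N - k)) %% N)%N.

(* j = k + 1 and j + 1 = k modulo N stand for j - k = 1 and j - k = -1, which
   avoids the truncated subtraction of nat. *)
Definition cyclic_diff2 (R : realType) (N : nat) : 'M[R]_N :=
  \matrix_(j, k)
    if j == k then - 2
    else if (j == k.+1 %[mod N])%N || (j.+1 == k %[mod N])%N then 1
    else 0.

Definition c_plus (R : realType) (N k : nat) : R :=
  let n : R := N%:R in let x : R := k%:R in
  ((1 - n ^+ 2) * (n ^+ 2 + 11)) / (720 * n) +
  (x * (n - x) * (n * x - x ^+ 2 + 2)) / (24 * n).

(* Main.v *)
(** The matrix [A] acts on the circulant matrix of a sequence as the cyclic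
    second difference. The sequence [c_plus] is the restriction of a quartic
    polynomial [c] in [k] that is symmetric under [k -> N - k]. The second
    difference of [c] is again such a symmetric polynomial, of degree 2, and it
    extends cyclically; the second difference of the latter is the constant
    [1 / N], except at [k = 0] where the wrap-around produces [1 / N - 1]. Hence
    [L *m circ c = 1 - J / N], with [J] the all-one matrix. As [J A = 0], and
    as the constant term of [c] is the one for which [J *m circ c = 0], the
    Penrose equations follow. *)
Require Import Defs.
From mathcomp Require Import all_boot all_order all_algebra.
From mathcomp Require Import reals.
From mathcomp Require Import zify ring.
Import GRing.Theory Num.Theory.
Local Open Scope ring_scope.

Lemma is_mpinvN (R : realType) (n : nat) (A X : 'M[R]_n) :
  is_mpinv A X -> is_mpinv (- A) (- X).
Proof.
by case=> AXA XAX AXt XAt; split; rewrite !(mulNmx, mulmxN) ?opprK ?AXA ?XAX.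
Qed.

Lemma mpinv_eq (R : realType) (n : nat) (A X : 'M[R]_n) :
  is_mpinv A X -> mpinv A = X.
Proof. exact: is_mpinv_unique (mpinvP A). Qed.

Lemma mpinvN (R : realType) (n : nat) (A : 'M[R]_n) : mpinv (- A) = - mpinv A.
Proof. exact/mpinv_eq/is_mpinvN/mpinvP. Qed.

(** Subtraction in ['I_m.+1] is modulo [m.+1], so entries can be handled by group arithmetic on
    indices. *)
Lemma circE (R : realType) (m : nat) (a : nat -> R) (i j : 'I_m.+1) :
  circ m.+1 a i j = a (i - j).
Proof. by rewrite mxE /= modnDmr. Qed.

Lemma ord_addr1 (m : nat) (i : 'I_m.+2) :
  i + 1 = (if i.+1 == m.+2 then 0 else i.+1)%N :> nat.
Proof.
have ltim := ltn_ord i; rewrite /= addn1.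
by case: eqP => [->|neq]; [rewrite modnn | rewrite modn_small; lia].
Qed.

Lemma ord_subr1 (m : nat) (i : 'I_m.+2) :
  i - 1 = (if i == 0 :> nat then m.+1 else i.-1)%N :> nat.
Proof.
have ltim := ltn_ord i; rewrite /= subn1 /= modnDmr.
case: eqP => [->|neq]; first by rewrite modn_small.
have -> : (i + m.+1 = i.-1 + m.+2)%N by lia.
by rewrite modnDr modn_small; lia.
Qed.

Lemma circ_tr (R : realType) (N : nat) (a : nat -> R) :
  (forall k, (k <= N)%N -> a (N - k)%N = a k) -> (circ N a)^T = circ N a.
Proof.
case: N => [|m] sym_a; apply/matrixP => i j; first by case: i.
rewrite mxE !circE -(opprB i j); move: (i - j) => x.
have := ltn_ord x; case: (posnP x) => [x0|x_gt0] ltxm.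
  by rewrite /= x0 subn0 modnn.
by rewrite /= modn_small ?sym_a //; lia.
Qed.

(** Every column of a circulant matrix permutes the same values, so all column sums agree. *)
Lemma mul_const_circ (R : realType) (N : nat) (x : R) (a : nat -> R) :
  const_mx x *m circ N a = const_mx (x * \sum_(k < N) a k) :> 'M_N.
Proof.
case: N => [|m]; apply/matrixP => i j; first by case: i.
rewrite !mxE mulr_sumr (reindex_inj (addIr j)).
by apply: eq_bigr => k _; rewrite [X in X * _]mxE circE addrK.
Qed.

Lemma tr_cyclic_diff2 (R : realType) (N : nat) :
  (cyclic_diff2 R N)^T = cyclic_diff2 R N.
Proof.
apply/matrixP => i j; rewrite !mxE eq_sym orbC.
by rewrite (eq_sym (i %% _)%N) (eq_sym (i.+1 %% _)%N).
Qed.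

Lemma cyclic_diff2E (R : realType) (m : nat) (i j : 'I_m.+3) :
  cyclic_diff2 R m.+3 i j =
    (j == i + 1)%:R + (j == i - 1)%:R - 2 * (j == i)%:R.
Proof.
have modS (k : 'I_m.+3) : (k.+1 %% m.+3 = (k + 1)%R)%N.
  by rewrite /= addn1.
rewrite mxE !modS !(modn_small (ltn_ord _)) !val_eqE -subr_eq.
rewrite !(eq_sym j) orbC.
have jS : (j + 1 == j) = false by rewrite -subr_eq0 addrC addKr oner_eq0.
have [->|_] := eqVneq i j.
  by rewrite subr_eq (eq_sym j) jS add0r mulr1 sub0r.
rewrite mulr0 subr0; have [<-|_] /= := eqVneq (i + 1) j; last first.
  by rewrite add0r; case: eqP.
(* In size 2 the two neighbours of [i] would coincide; here [1 + 1] is a nonzero residue. *)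
have -> : (i - 1 == i + 1) = false.
  by rewrite (inj_eq (addrI i)) eq_sym -subr_eq0 opprK -val_eqE /= modn_small.
by rewrite addr0.
Qed.

Lemma mul_cyclic_diff2 (R : realType) (m n : nat) (M : 'M[R]_(m.+3, n)) i j :
  (cyclic_diff2 R m.+3 *m M) i j = M (i + 1) j + M (i - 1) j - 2 * M i j.
Proof.
have pick (k : 'I_m.+3) : \sum_l (l == k)%:R * M l j = M k j.
  rewrite (bigD1 k) //= eqxx mul1r big1 ?addr0 // => l /negPf->.
  by rewrite mul0r.
rewrite mxE -!pick mulr_sumr -sumrN -!big_split /=.
by apply: eq_bigr => l _; rewrite cyclic_diff2E; ring.
Qed.

(** Sequences live on [nat]: [a N = a 0] closes the cycle at the last index, while index 0, whose
    cyclic predecessor is [N.-1], gets its own equation. *)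
Lemma mul_cyclic_diff2_circ (R : realType) (N : nat) (a b : nat -> R) :
    (3 <= N)%N -> a N = a 0%N ->
    b 0%N = a 1%N + a N.-1 - 2 * a 0%N ->
    (forall k, (k.+1 < N)%N -> b k.+1 = a k.+2 + a k - 2 * a k.+1) ->
  cyclic_diff2 R N *m circ N a = circ N b.
Proof.
case: N => [|[|[|m]]] // _ aN b0 bS; apply/matrixP => i j.
rewrite mul_cyclic_diff2 !circE (addrAC i) (addrAC i (-1)).
set x := i - j; have := ltn_ord x; rewrite ord_addr1 ord_subr1.
case: (nat_of_ord x) => [|k] ltkm; first by rewrite b0.
by rewrite bS //=; case: eqP => // ->; rewrite aN.
Qed.

Lemma c_plus_sub (R : realType) (N k : nat) :
  (k <= N)%N -> c_plus R N (N - k) = c_plus R N k.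
Proof.
move=> lekN; rewrite /c_plus natrB //; congr (_ + _ / _); ring.
Qed.

Lemma sum_c_plus (R : realType) (N : nat) :
  (0 < N)%N -> \sum_(k < N) c_plus R N k = 0.
Proof.
move=> N_gt0; pose n : R := N%:R; have n0 : n != 0 by rewrite pnatr_eq0 -lt0n.
(* Faulhaber's formulas for the sums of k, k ^ 2, k ^ 3 and k ^ 4 over k < m,
   applied to the expansion of c_plus. *)
have sumE m : \sum_(k < m) c_plus R N k = let x : R := m%:R in
    (1 - n ^+ 2) * (n ^+ 2 + 11) / (720 * n) * x +
    (2 * n * (x * (x - 1) / 2) +
     (n ^+ 2 - 2) * (x * (x - 1) * (2 * x - 1) / 6) -
     2 * n * (x ^+ 2 * (x - 1) ^+ 2 / 4) +
     x * (x - 1) * (2 * x - 1) * (3 * x ^+ 2 - 3 * x - 1) / 30) / (24 * n).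
  elim: m => [|m IHm] /=; first by rewrite big_ord0; field.
  by rewrite big_ord_recr /= IHm /c_plus -/n -natr1; field.
by rewrite sumE /= -/n; field.
Qed.

(** For [3 <= N] this sequence generates the Moore-Penrose inverse of [- cyclic_diff2 R N], the
    Laplacian of the cycle on [N] vertices. *)
Definition diff2_c_plus (R : realType) (N k : nat) : R :=
  (6 * k%:R ^+ 2 - 6 * N%:R * k%:R + N%:R ^+ 2 - 1) / (12 * N%:R).

Lemma mul_cyclic_diff2_c_plus (R : realType) (N : nat) : (3 <= N)%N ->
  cyclic_diff2 R N *m circ N (c_plus R N) = circ N (diff2_c_plus R N).
Proof.
move=> hN; have n0 : N%:R != 0 :> R by rewrite pnatr_eq0; lia.
apply: mul_cyclic_diff2_circ => // [||k _].
- by rewrite -[RHS]c_plus_sub // subn0.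
- rewrite -subn1 c_plus_sub; last lia.
  by rewrite /c_plus /diff2_c_plus; field.
- by rewrite /c_plus /diff2_c_plus -!natr1; field.
Qed.

Lemma mul_cyclic_diff2_diff2_c_plus (R : realType) (N : nat) : (3 <= N)%N ->
  cyclic_diff2 R N *m circ N (diff2_c_plus R N) =
    const_mx N%:R^-1 - 1%:M.
Proof.
move=> hN; have n0 : N%:R != 0 :> R by rewrite pnatr_eq0; lia.
transitivity (circ N (fun k => N%:R^-1 - (k == 0)%:R : R)); last first.
  case: N {hN n0} => [|m]; apply/matrixP => i j; first by case: i.
  by rewrite circE !mxE -subr_eq0.
apply: mul_cyclic_diff2_circ => // [||k _].
- by rewrite /diff2_c_plus; field.
(* The quadratic is smaller by 1 at [N - 1] than at [-1], whence the extra [-1] at index 0. *)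
- rewrite /diff2_c_plus /= -subn1 natrB; last lia.
  by field.
- by rewrite /diff2_c_plus -!natr1 /=; field.
Qed.

(** By symmetry of the second factor, transposition leads to the second difference of a constant
    sequence. *)
Lemma mul_const_cyclic_diff2 (R : realType) (N : nat) (x : R) : (3 <= N)%N ->
  const_mx x *m cyclic_diff2 R N = 0 :> 'M_N.
Proof.
move=> hN; apply: trmx_inj; rewrite trmx_mul tr_cyclic_diff2 trmx_const trmx0.
have constE (y : R) : const_mx y = circ N (fun=> y).
  by apply/matrixP => i j; rewrite !mxE.
rewrite -[RHS]/(const_mx 0) !constE.
by apply: mul_cyclic_diff2_circ => // *; ring.
Qed.

Lemma is_mpinv_c_plus (R : realType) (N : nat) : (3 <= N)%N ->
  is_mpinv (- (cyclic_diff2 R N ^+ 2)) (circ N (c_plus R N)).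
Proof.
move=> hN; set A := cyclic_diff2 R N; set X := circ N _.
have At : A^T = A by exact: tr_cyclic_diff2.
have Xt : X^T = X by apply/circ_tr => k; exact: c_plus_sub.
have -> : A ^+ 2 = A *m A by [].
have Lt : (- (A *m A))^T = - (A *m A) by rewrite linearN /= trmx_mul At.
(* [P] is the orthogonal projection onto the vectors with coordinate sum zero. *)
pose P : 'M[R]_N := 1%:M - const_mx N%:R^-1.
have LX : - (A *m A) *m X = P.
  rewrite mulNmx -mulmxA mul_cyclic_diff2_c_plus //.
  by rewrite mul_cyclic_diff2_diff2_c_plus // opprB.
have Pt : P^T = P by rewrite linearB /= trmx_const tr_scalar_mx.
have XL : X *m - (A *m A) = P by rewrite -Xt -Lt -trmx_mul LX Pt.
split; rewrite ?LX ?XL //.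
(* What remains is that left multiplication by [P] fixes [- (A *m A)] and [X]. *)
- by rewrite mulmxN mulmxA mulmxBl mul1mx mul_const_cyclic_diff2 // subr0.
- rewrite mulmxBl mul1mx mul_const_circ sum_c_plus; last lia.
  by rewrite mulr0 subr0.
Qed.

Theorem theorem2p3 (R : realType) (N : nat) (hN : (3 <= N)%N) :
  let A : 'M[R]_N := cyclic_diff2 R N in
  let L : 'M[R]_N := - (A ^+ 2) in
  [/\ (mpinv L)^T = mpinv L,
      mpinv L = - mpinv (A ^+ 2) &
      mpinv L = circ N (c_plus R N)].
Proof.
move=> A L; have LE := mpinv_eq _ _ _ _ (is_mpinv_c_plus R _ hN).
split; [|exact: mpinvN|exact: LE].
by rewrite LE; apply: circ_tr => k; exact: c_plus_sub.
Qed.
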